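(* Let $M_1=(J,\Sigma,\mu,\mathcal F_1)$ and $M_2=(J,\Sigma,\mu,\mathcal F_2)$ be measurable matroids on the same standard measure space. Then $M=(J,\Sigma,\mu,\mathcal F_1+\mathcal F_2)$ is a measurable pre-matroid, where $\mathcal F_1+\mathcal F_2=\{F_1\cup F_2\mid F_1\in\mathcal F_1,\ F_2\in\mathcal F_2\}$.
   Context: A standard measure space $(J,\Sigma,\mu)$ is a standard Borel space $(J,\Sigma)$ with a finite atomless measure $\mu\colon\Sigma\to[0,\infty)$. Convention: measurable sets are identified when they differ by a $\mu$-null set: $A=B$ means $\mu(A\triangle B)=0$, $A\subseteq B$ means $\mu(A\setminus B)=0$, and families of measurable sets are families in the measure algebra (membership is unaffected by null modifications). All sets are assumed measurable. A set $X$ in a family $\mathcal X$ is maximal in $\mathcal X$ if $X\subseteq Y\in\mathcal X$ implies $Y\subseteq X$. Write $\mathcal X|Z=\{X\in\mathcal X\mid X\subseteq Z\}$. Axioms for a family $\mathcal F\subseteq\Sigma$: (I1) $\emptyset\in\mathcal F$; (I2) $F_1\subseteq F_2\in\mathcal F$ implies $F_1\in\mathcal F$; (I3) for all $X\in\Sigma$ and all maximal $F_1,F_2\in\mathcal F|X$, $\mu(F_1)=\mu(F_2)$; (I4) if $(F_i)_{i\in\mathbb N}$ is an increasing sequence in $\mathcal F$, then $\bigcup_i F_i\in\mathcal F$; (I3'') for $F_1,F_2\in\mathcal F$ with $\mu(F_1)\le\mu(F_2)$, there exists $G\in\mathcal F$ with $F_1\subseteq G\subseteq F_1\cup F_2$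 and $\mu(G)\ge\mu(F_2)$. $(J,\Sigma,\mu,\mathcal F)$, with $(J,\Sigma,\mu)$ a standard measure space, is a measurable matroid if $\mathcal F$ satisfies (I1), (I2), (I3), (I4), and a measurable pre-matroid if $\mathcal F$ satisfies (I1), (I2), (I3''). *)

(* Defs.v *)
From HB Require Import structures.
From mathcomp Require Import all_boot all_order all_algebra.
From mathcomp Require Import all_classical all_reals all_analysis.

Set Implicit Arguments.
Unset Strict Implicit.
Unset Printing Implicit Defensive.

Import Order.TTheory GRing.Theory Num.Theory.

Local Open Scope classical_set_scope.
Local Open Scope ring_scope.
Local Open Scope ereal_scope.

(* Separable complete metric space. The existential replaces [cvg], which is
   only available on pointed types. *)
Definition polish (R : realType) (X : metricType R) : Prop :=
  (forall F : set_system X, ProperFilter F -> cauchy F ->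
     exists x : X, F --> x) /\
  (exists2 D : set X, countable D & dense D).

(* The measurable space is isomorphic, via the bijection [f], to a Polish space
   with its Borel sigma-algebra. *)
Definition standard_borel (R : realType) (d : measure_display)
    (J : measurableType d) : Prop :=
  exists X : metricType R, polish X /\
    exists f : J -> X, bijective f /\
      forall B : set X, <<s @open X >> B <-> measurable (f @^-1` B).

Section measurable_matroids.
Context (R : realType) (d : measure_display) (J : measurableType d).
Variable mu : {finite_measure set J -> \bar R}.

Implicit Types (A B X G F : set J) (FF : set (set J)).

Definition atomless : Prop :=
  forall A, measurable A -> 0 < mu A ->
    exists B, [/\ measurable B, B `<=` A, 0 < mu B & mu B < mu A].

Definition standard_measure_space : Prop := standard_borel R J /\ atomless.

(* Equality and inclusion in the measure algebra. *)
Definition null_eq A B : Prop := mu (A `+` B) = 0.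
Definition null_subset A B : Prop := mu (A `\` B) = 0.

(* A family in the measure algebra is represented by the set of all
   measurable representatives of its members. *)
Definition measure_algebra_family FF : Prop :=
  FF `<=` measurable /\
  forall A B, FF A -> measurable B -> null_eq A B -> FF B.

Definition family_restr FF X : set (set J) := [set A | FF A /\ null_subset A X].

Definition maximal_in FF A : Prop :=
  FF A /\ forall B, FF B -> null_subset A B -> null_subset B A.

Definition axiom_I1 FF : Prop := FF set0.

Definition axiom_I2 FF : Prop :=
  forall F1 F2, measurable F1 -> FF F2 -> null_subset F1 F2 -> FF F1.

Definition axiom_I3 FF : Prop :=
  forall X, measurable X -> forall F1 F2,
    maximal_in (family_restr FF X) F1 -> maximal_in (family_restr FF X) F2 ->
    mu F1 = mu F2.

Definition axiom_I4 FF : Prop :=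
  forall A : (set J)^nat, (forall i, FF (A i)) ->
    (forall i, null_subset (A i) (A i.+1)) -> FF (\bigcup_i A i).

Definition axiom_I3'' FF : Prop :=
  forall F1 F2, FF F1 -> FF F2 -> mu F1 <= mu F2 ->
    exists G, [/\ FF G, null_subset F1 G, null_subset G (F1 `|` F2)
                & mu F2 <= mu G].

Definition measurable_matroid FF : Prop :=
  [/\ standard_measure_space, measure_algebra_family FF
    & [/\ axiom_I1 FF, axiom_I2 FF, axiom_I3 FF & axiom_I4 FF]].

Definition measurable_pre_matroid FF : Prop :=
  [/\ standard_measure_space, measure_algebra_family FF
    & [/\ axiom_I1 FF, axiom_I2 FF & axiom_I3'' FF]].

(* {F1 U F2 | F1 in FF1, F2 in FF2}, with equality read in the measure
   algebra. *)
Definition family_sum FF1 FF2 : set (set J) :=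
  [set A | measurable A /\
    exists F1 F2, [/\ FF1 F1, FF2 F2 & null_eq A (F1 `|` F2)]].

End measurable_matroids.

(* Main.v *)
Require Import Defs.
From HB Require Import structures.
From mathcomp Require Import all_boot all_order all_algebra.
From mathcomp Require Import all_classical all_reals all_analysis.

(** The proof is the exchange argument for unions of finite matroids, with a
minimal choice replaced by a limit argument.

A member of the sum family is exactly a disjoint union of a member of the first
family and a member of the second ([family_sumP]); downward closure of the sum
follows by intersecting the two pieces. For the exchange axiom, let [P `|` Q] be
the set to be extended and let [B1 `|` B2] be the target. Consider all disjoint
pairs [(X, Y)] of independent sets that cover [P `|` Q] inside
[P `|` Q `|` B1 `|` B2]. Suppose that such a pair is smaller than the target.
Then, up to symmetry, [mu X < mu B1], and augmenting [X] by elements of [B1]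
gives a larger independent set [H] ([augmentation]). The pair [(H, Y `\` H)] is
again admissible: elements of [Y] claimed by [H] move from the second piece to
the first one. The move may leave the measure of the union unchanged, but it
strictly decreases the distance
[mu (X `+` B1) + mu (Y `+` B2)], since everything that moves lies in [B1] and
outside [B2] ([disjoint_cover_exchange]). So a pair that no admissible move
brings closer to [(B1, B2)] has a union at least as large as the target.

It remains to find such a pair. The moves shrink the two symmetric differences
as sets, not only in measure. Along a sequence of such moves each point
therefore changes its status finitely often, so that the pieces converge
pointwise; their limits inferior are increasing unions of independent sets,
hence independent, and they still cover [P `|` Q]. Every chain of moves indexed
by the natural numbers thus has an upper bound, and as the distance is a
real-valued monotone quantity this suffices for the existence of a terminal
pair ([ordering_principle]). The same principle yields maximal independent sets
inside a given set, on which axiom (I3) bears. *)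

Import Order.TTheory GRing.Theory Num.Theory.

Local Open Scope classical_set_scope.
Local Open Scope ring_scope.

(** * An ordering principle *)

(** The Brezis-Browder principle. Only sequences need upper bounds, in place of
the arbitrary chains of Zorn's lemma: at step [n] the gain in [phi] that is
still possible is at most [1 / (n + 1)], so nothing is left to gain above an
upper bound of the sequence. *)
Lemma ordering_principle (R : realType) (T : Type) (S : set T)
    (le : T -> T -> Prop) (phi : T -> R) (M : R) :
  (forall x, le x x) ->
  (forall x y z, le x y -> le y z -> le x z) ->
  (forall x y, S x -> S y -> le x y -> phi x <= phi y) ->
  (forall x, S x -> phi x <= M) ->
  (forall u : nat -> T, (forall n, S (u n)) -> (forall n, le (u n) (u n.+1)) ->
    exists2 y, S y & forall n, le (u n) y) ->
  forall x, S x -> exists y,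
    [/\ S y, le x y & forall z, S z -> le y z -> phi z <= phi y].
Proof.
move=> lexx trans_le phi_homo phi_ub le_seq x0 Sx0.
have step (nx : nat * T) : exists y, S nx.2 -> [/\ S y, le nx.2 y &
    forall z, S z -> le nx.2 z -> phi z <= phi y + nx.1.+1%:R^-1].
  case: nx => n x /=; have [Sx|nSx] := pselect (S x); last by exists x.
  pose V := [set phi z | z in [set z | S z /\ le x z]].
  have supV : has_sup V.
    split; first by exists (phi x); exists x.
    by exists M => _ [z [Sz _] <-]; exact: phi_ub.
  have n_gt0 : 0 < n.+1%:R^-1 :> R by rewrite invr_gt0.
  have [_ [y [Sy xy] <-] supy] := sup_adherent n_gt0 supV.
  exists y => _; split => // z Sz xz.
  have /le_trans : phi z <= sup V by apply: (ub_le_sup supV.2); exists z.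
  by apply; rewrite -lerBlDr ltW.
have {step} [g gP] := choice step.
pose u := fix u n := if n is m.+1 then g (m, u m) else x0.
have Su n : S (u n).
  by elim: n => //= n Su; have [] := gP (n, u n) Su.
have u_le n : le (u n) (u n.+1) by have [] := gP (n, u n) (Su n).
have [y Sy uy] := le_seq u Su u_le.
exists y; split => //; first exact: (uy 0%N).
move=> z Sz yz; apply/ler_addgt0Pr => e e_gt0.
have [n ne] := ltr_add_invr e_gt0.
have [_ _ /(_ z Sz (trans_le _ _ _ (uy n) yz))] := gP (n, u n) (Su n).
move=> /le_trans; apply; apply: lerD; first exact: phi_homo (uy n.+1).
by rewrite -[leLHS]add0r ltW.
Qed.

(** * Sets approaching a target pointwise *)

Section closer.
Context {T : Type}.
Implicit Types (C X Y : set T) (u : nat -> set T).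

(** The symmetric difference to [C] shrinks exactly when elements are gained only
inside [C] and lost only outside [C]. *)
Definition closer C X Y : Prop := Y `+` C `<=` X `+` C.

Definition set_liminf u : set T :=
  \bigcup_n \bigcap_(k in [set k | (n <= k)%N]) u k.

Lemma closer_trans C X Y Z : closer C X Y -> closer C Y Z -> closer C X Z.
Proof. by move=> XY YZ; exact: subset_trans YZ XY. Qed.

Lemma closer_seq {C u} : (forall n, closer C (u n) (u n.+1)) ->
  forall n k, (n <= k)%N -> closer C (u n) (u k).
Proof.
move=> uS n; elim=> [|k IHk].
  by rewrite leqn0 => /eqP ->; exact: subset_refl.
rewrite leq_eqVlt ltnS => /predU1P[->|/IHk nk]; first exact: subset_refl.
exact: closer_trans nk (uS k).
Qed.

(** A point leaves the decreasing sets [u n `+` C] at most once, and its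
membership in [u n] is determined by its membership in [u n `+` C] and [C]. *)
Lemma closer_seq_stationary C u x : (forall n, closer C (u n) (u n.+1)) ->
  exists n, (forall k, (n <= k)%N -> u k x) \/ (forall k, (n <= k)%N -> ~ u k x).
Proof.
move=> /closer_seq u_le.
have [[n nun]|/forallNP ux] := pselect (exists n, ~ (u n `+` C) x).
  have nu k : (n <= k)%N -> ~ (u k `+` C) x by move=> /u_le nk /nk.
  exists n; have [Cx|nCx] := pselect (C x); [left|right] => k /nu /= nY.
    by apply: contrapT => nux; apply: nY; right.
  by move=> ux; apply: nY; left.
exists 0%N; have [Cx|nCx] := pselect (C x); [right|left] => k _;
  by have /contrapT[] := ux k => -[].
Qed.

Lemma closer_liminf C u : (forall n, closer C (u n) (u n.+1)) ->
  forall n, closer C (u n) (set_liminf u).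
Proof.
move=> uS n x lx; have [m um] := closer_seq_stationary C u x uS.
have le_n : (n <= maxn m n)%N by exact: leq_maxr.
have le_m : (m <= maxn m n)%N by exact: leq_maxl.
apply: (closer_seq uS _ _ le_n).
case: lx => -[lx nCx]; [left|right]; split => //.
  case: um => um; first exact: um.
  case: lx => p _ /(_ (maxn p m))/=; rewrite leq_maxl => /(_ isT) /um.
  by rewrite leq_maxr => /(_ isT).
move=> ux; apply: nCx; case: um => um; last by case: (um _ le_m ux).
by exists m.
Qed.

(** The union of the limits could lose a point that alternates between the two
sequences; stationarity of both sequences excludes this. *)
Lemma liminf_cover {C D u v} : (forall n, closer C (u n) (u n.+1)) ->
  (forall n, closer D (v n) (v n.+1)) ->
  \bigcap_n (u n `|` v n) `<=` set_liminf u `|` set_liminf v.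
Proof.
move=> uS vS x uvx.
have [n [un|nun]] := closer_seq_stationary C u x uS; first by left; exists n.
have [m [vm|nvm]] := closer_seq_stationary D v x vS; first by right; exists m.
have [/nun|/nvm] := uvx (maxn n m) I; first by rewrite leq_maxl => /(_ isT).
by rewrite leq_maxr => /(_ isT).
Qed.

Lemma liminf_sub u X : (forall n, u n `<=` X) -> set_liminf u `<=` X.
Proof. by move=> uX x [n _ /(_ n (leqnn n)) /uX]. Qed.

Lemma liminf_disjoint u v : (forall n, u n `&` v n = set0) ->
  set_liminf u `&` set_liminf v = set0.
Proof.
move=> uv; rewrite -subset0 => x [[n _ un] [m _ vm]].
rewrite -(uv (maxn n m)); split; [exact: un (leq_maxl n m)|].
exact: vm (leq_maxr n m).
Qed.

End closer.

(** * Maximal members and augmentation *)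

Section matroid_sum.
Context (R : realType) (d : measure_display) (J : measurableType d).
Variable mu : {finite_measure set J -> \bar R}.
Implicit Types (A B F G H P Q X : set J) (FF : set (set J)).

Lemma sub_null_subset A B : A `<=` B -> null_subset mu A B.
Proof. by rewrite /null_subset -setD_eq0 => ->; rewrite measure0. Qed.

Lemma sub_axiom_I2 {FF A B} : axiom_I2 mu FF -> measurable A -> FF B ->
  A `<=` B -> FF A.
Proof. by move=> I2 mA FB AB; apply: (I2 _ _ mA FB); exact: sub_null_subset. Qed.

Lemma null_setU A B : measurable A -> measurable B ->
  mu A = 0%E -> mu B = 0%E -> mu (A `|` B) = 0%E.
Proof. by move=> mA mB A0 B0; rewrite measureU0. Qed.

Lemma le_mu A B : measurable A -> measurable B -> A `<=` B -> (mu A <= mu B)%E.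
Proof. by move=> mA mB; apply: le_measure; rewrite inE. Qed.

Lemma lt_mu A B : measurable A -> measurable B -> A `<=` B ->
  mu (B `\` A) != 0%E -> (mu A < mu B)%E.
Proof.
move=> mA mB AB BA0; rewrite (measureDI mu mB mA) setIidr//.
by rewrite -[ltLHS]add0e lteD2rE ?fin_num_measure// lt0e BA0 measure_ge0.
Qed.

(** The ordering principle is applied to genuine inclusion. Maximality up to null
sets follows: if [B] in the family contains [H] up to a null set, then so is
[H `|` (B `&` X)], which genuinely contains [H]. *)
Lemma maximal_extension FF F X : FF `<=` measurable -> axiom_I2 mu FF ->
  axiom_I4 mu FF -> measurable X -> FF F -> F `<=` X ->
  exists2 H, F `<=` H & H `<=` X /\ maximal_in mu (family_restr mu FF X) H.
Proof.
move=> FFm I2 I4 mX FF_F FX.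
pose S := [set H | FF H /\ H `<=` X].
have [|||||H [[FH HX] FsubH Hmax]] :=
  @ordering_principle R _ S subset (fun H => fine (mu H)) (fine (mu X))
    _ _ _ _ _ F (conj FF_F FX).
- exact: subset_refl.
- by move=> A B C; exact: subset_trans.
- move=> A B [/FFm mA _] [/FFm mB _] AB.
  by rewrite fine_le ?fin_num_measure// le_mu.
- by move=> A [/FFm mA AX]; rewrite fine_le ?fin_num_measure// le_mu.
- move=> u Su uS; exists (\bigcup_n u n); last by move=> n; exact: bigcup_sup.
  split; last by apply: bigcup_sub => n _; case: (Su n).
  apply: I4 => n; first by case: (Su n).
  exact: sub_null_subset.
exists H => //; split => //; split; first by split => //; exact: sub_null_subset.
move=> B [FB BX] HB.
have [mH mB] := (FFm _ FH, FFm _ FB).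
have mBX : measurable (B `&` X) by exact: measurableI.
have mN : measurable (H `|` (B `&` X)) by exact: measurableU.
have SN : S (H `|` (B `&` X)).
  split; last by move=> x [/HX|[]].
  apply: (I2 _ _ mN FB); apply: subset_measure0 HB => //; try exact: measurableD.
  by move=> x [[?|[? ?]] ?]//; split.
have HN : H `<=` H `|` (B `&` X) by exact: subsetUl.
have N0 : mu ((H `|` (B `&` X)) `\` H) = 0%E.
  apply/eqP; apply: contraTT (Hmax _ SN HN) => /(lt_mu _ _ mH mN HN).
  by rewrite -ltNge => lt; rewrite fine_lt ?fin_num_measure.
have := null_setU _ _ (measurableD mN mH) (measurableD mB mX) N0 BX.
apply: subset_measure0; [exact: measurableD|apply: measurableU; exact: measurableD|].
move=> x [Bx nHx]; have [Xx|nXx] := pselect (X x); last by right.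
by left; split => //; right.
Qed.

(** Extend both [F] and [G] to maximal members inside [F `|` G]; by (I3) the two
extensions have the same measure, and the second one is at least [mu G]. *)
Lemma augmentation FF F G : measurable_matroid mu FF -> FF F -> FF G ->
  exists2 H, FF H & [/\ F `<=` H, H `<=` F `|` G & (mu G <= mu H)%E].
Proof.
move=> [_ [FFm _] [_ I2 I3 I4]] FF_F FF_G.
have mX : measurable (F `|` G) by apply: measurableU; exact: FFm.
have [H FH [HX Hmax]] := maximal_extension _ _ _ FFm I2 I4 mX FF_F (@subsetUl _ F G).
have [K GK [KX Kmax]] := maximal_extension _ _ _ FFm I2 I4 mX FF_G (@subsetUr _ F G).
have FFH : FF H by case: Hmax => -[].
exists H => //; split => //; rewrite (I3 _ mX _ _ Hmax Kmax).
by apply: le_mu GK; apply: FFm => //; case: Kmax => -[].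
Qed.

(** * Exchanging points between the two pieces *)

Lemma matroid_liminf FF (u : nat -> set J) : measurable_matroid mu FF ->
  (forall n, FF (u n)) -> FF (set_liminf u).
Proof.
move=> [_ [FFm _] [_ I2 _ I4]] FFu; apply: I4 => n.
  apply: (sub_axiom_I2 I2 _ (FFu n)); last by move=> x; apply; exact: leqnn.
  by apply: bigcap_measurable => [|k _]; [exists n => /=|exact: FFm].
by apply: sub_null_subset => x u_x k /ltnW; exact: u_x.
Qed.

Definition disjoint_cover FF1 FF2 A B (PQ : set J * set J) : Prop :=
  [/\ FF1 PQ.1, FF2 PQ.2, PQ.1 `&` PQ.2 = set0, A `<=` PQ.1 `|` PQ.2
    & PQ.1 `|` PQ.2 `<=` A `|` B].

Lemma disjoint_cover_swap {FF1 FF2 A B P Q} :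
  disjoint_cover FF1 FF2 A B (P, Q) -> disjoint_cover FF2 FF1 A B (Q, P).
Proof. by case=> /= *; split => //=; rewrite 1?setIC// setUC. Qed.

(** The new pair is [(H, Q `\` H)], where [H] augments [P] inside [P `|` B1].
What [Q] loses lies in [B1], since [P] and [Q] are disjoint, hence outside
[B2]; so the second piece gets closer to [B2] as well. *)
Lemma disjoint_cover_exchange {FF1 FF2 A B P Q B1 B2} :
  measurable_matroid mu FF1 -> measurable_matroid mu FF2 -> FF1 B1 ->
  B1 `&` B2 = set0 -> B1 `<=` B -> disjoint_cover FF1 FF2 A B (P, Q) ->
  (mu P < mu B1)%E ->
  exists P' Q', [/\ disjoint_cover FF1 FF2 A B (P', Q'), closer B1 P P',
    closer B2 Q Q' & (mu (P' `+` B1) < mu (P `+` B1))%E].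
Proof.
move=> mat1 [_ [FF2m _] [_ I2 _ _]] FB1 B12 B1B [/= FP FQ PQ APQ PQB] ltPB1.
have [H FH [PH HPB leB1H]] := augmentation _ _ _ mat1 FP FB1.
have [_ [FF1m _] _] := mat1.
have [[[mP mH] mB1] mQ] := (FF1m _ FP, FF1m _ FH, FF1m _ FB1, FF2m _ FQ).
have mY X : measurable X -> measurable (X `+` B1).
  by move=> mX; apply: measurableU; exact: measurableD.
have closerH : closer B1 P H.
  move=> x [[/HPB[Px|//] nBx]|[Bx nHx]]; first by left.
  by right; split => // /PH.
exists H, (Q `\` H); split => //.
- split => //=.
  + by apply: (sub_axiom_I2 I2 _ FQ) => //; exact: measurableD.
  + by rewrite setDE setICA setICr setI0.
  + move=> x /APQ[/PH|Qx]; first by left.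
    by have [|nHx] := pselect (H x); [left|right].
  + move=> x [/HPB[Px|/B1B]|[Qx _]]; [apply: PQB; by left|by right|].
    by apply: PQB; right.
- move=> x [[[Qx _] nBx]|[Bx nQHx]]; first by left.
  right; split => // Qx; apply: nQHx; split => // /HPB[Px|B1x].
    by have : (P `&` Q) x by []; rewrite PQ.
  by have : (B1 `&` B2) x by []; rewrite B12.
- apply: lt_mu => //; try exact: mY.
  (* The distance drops by all of [H `\` P], which lies in [B1] and is not null
     because [mu P < mu H]. *)
  apply: contraTneq (lt_le_trans ltPB1 leB1H) => gap0.
  rewrite -leNgt (measureDI mu mH mP) setIidr//.
  suff HP0 : mu (H `\` P) = 0%E by rewrite [X in (X + _)%E]HP0 add0e.
  apply: subset_measure0 gap0; first exact: measurableD.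
    by apply: measurableD; exact: mY.
  move=> x [Hx nPx]; have B1x : B1 x by case/HPB: Hx.
  by split; [right|case => -[]].
Qed.

(** A pair from which no exchange gets closer to [(B1, B2)] is large enough:
its pieces are disjoint, so a union smaller than [B1 `|` B2] would have a piece
smaller than its target. *)
Lemma disjoint_cover_large {FF1 FF2 P Q B1 B2} :
  measurable_matroid mu FF1 -> measurable_matroid mu FF2 ->
  FF1 P -> FF2 Q -> P `&` Q = set0 -> FF1 B1 -> FF2 B2 -> B1 `&` B2 = set0 ->
  exists2 PQ, disjoint_cover FF1 FF2 (P `|` Q) (B1 `|` B2) PQ &
    (mu (B1 `|` B2) <= mu (PQ.1 `|` PQ.2))%E.
Proof.
move=> mat1 mat2 FP FQ PQ0 FB1 FB2 B12.
have [[_ [FF1m _] _] [_ [FF2m _] _]] := (mat1, mat2).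
have [mB1 mB2] := (FF1m _ FB1, FF2m _ FB2).
have mY C X : measurable X -> measurable C -> measurable (X `+` C).
  by move=> mX mC; apply: measurableU; exact: measurableD.
set A := P `|` Q; set B := B1 `|` B2.
pose le (x y : set J * set J) := closer B1 x.1 y.1 /\ closer B2 x.2 y.2.
pose phi (x : set J * set J) :=
  - (fine (mu (x.1 `+` B1)) + fine (mu (x.2 `+` B2))).
have cover0 : disjoint_cover FF1 FF2 A B (P, Q) by split => //; exact: subsetUl.
have [|||||[P' Q'] [cov _ PQmax]] :=
  @ordering_principle R _ (disjoint_cover FF1 FF2 A B) le phi 0 _ _ _ _ _ _ cover0.
- by move=> x; split; exact: subset_refl.
- move=> x y z [xy1 xy2] [yz1 yz2].
  by split; [exact: closer_trans yz1|exact: closer_trans yz2].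
- move=> [X1 X2] [Y1 Y2] [/= /FF1m mX1 /FF2m mX2 _ _ _].
  move=> [/= /FF1m mY1 /FF2m mY2 _ _ _] [/= c1 c2].
  by rewrite /phi/= lerN2 lerD// fine_le ?fin_num_measure ?le_mu//; exact: mY.
- by move=> x _; rewrite oppr_le0 addr_ge0// fine_ge0.
- move=> u cu uS; pose P_ n := (u n).1; pose Q_ n := (u n).2.
  have PS n : closer B1 (P_ n) (P_ n.+1) by case: (uS n).
  have QS n : closer B2 (Q_ n) (Q_ n.+1) by case: (uS n).
  exists (set_liminf P_, set_liminf Q_).
    split => /=.
    + by apply: matroid_liminf => // n; case: (cu n).
    + by apply: matroid_liminf => // n; case: (cu n).
    + by apply: liminf_disjoint => n; case: (cu n).
    + apply: subset_trans (liminf_cover PS QS).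
      by move=> x Ax n _; case: (cu n) => _ _ _ /(_ x Ax).
    + rewrite subUset; split; apply: liminf_sub => n; case: (cu n) => _ _ _ _;
      by rewrite subUset => -[].
  by move=> n; split; exact: closer_liminf.
exists (P', Q') => //=; have [/= FP' FQ' PQ0' _ _] := cov.
have [mP mQ] := (FF1m _ FP', FF2m _ FQ').
rewrite leNgt; apply/negP; rewrite !measureU// => lt_sum.
have [ltP|leP] := ltP (mu P') (mu B1).
  have [X [Y [cXY cX cY lt]]] :=
    disjoint_cover_exchange mat1 mat2 FB1 B12 (@subsetUl _ B1 B2) cov ltP.
  have [/= /FF1m mX /FF2m mY' _ _ _] := cXY.
  have := PQmax _ cXY (conj cX cY); rewrite /phi/= lerN2 leNgt => /negP; apply.
  apply: ltr_leD; first by rewrite fine_lt ?fin_num_measure//; exact: mY.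
  by rewrite fine_le ?fin_num_measure ?le_mu//; exact: mY.
have ltQ : (mu Q' < mu B2)%E.
  rewrite ltNge; apply/negP => leQ.
  by move: lt_sum; rewrite ltNge leeD.
have B21 : B2 `&` B1 = set0 by rewrite setIC.
(* The second piece falls short: the same exchange with the roles swapped. *)
have [X [Y [cXY cX cY lt]]] :=
  disjoint_cover_exchange mat2 mat1 FB2 B21 (@subsetUr _ B1 B2)
    (disjoint_cover_swap cov) ltQ.
have [/= /FF2m mX /FF1m mY' _ _ _] := cXY.
have := PQmax _ (disjoint_cover_swap cXY) (conj cY cX).
rewrite /phi/= lerN2 leNgt => /negP; apply.
apply: ler_ltD; last by rewrite fine_lt ?fin_num_measure//; exact: mY.
by rewrite fine_le ?fin_num_measure ?le_mu//; exact: mY.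
Qed.

(** * The sum family *)

(** Passing to a disjoint genuine decomposition absorbs the null set that
[family_sum] allows: take [A `&` F1] and [A `\` F1], the latter being contained
in [F2] up to a null set. *)
Lemma family_sumP {FF1 FF2 A} :
  measurable_matroid mu FF1 -> measurable_matroid mu FF2 ->
  family_sum mu FF1 FF2 A <->
  exists P Q, [/\ FF1 P, FF2 Q, P `&` Q = set0 & A = P `|` Q].
Proof.
move=> [_ [FF1m _] [_ I2 _ _]] [_ [FF2m _] [_ I2' _ _]].
split=> [[mA [F1 [F2 [FF_F1 FF_F2 AF]]]]|[P [Q [FP FQ _ ->]]]].
  have [mF1 mF2] := (FF1m _ FF_F1, FF2m _ FF_F2).
  exists (A `&` F1), (A `\` F1); split.
  - by apply: (sub_axiom_I2 I2 _ FF_F1) => //; exact: measurableI.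
  - apply: (I2' _ _ (measurableD mA mF1) FF_F2).
    have mF := measurableU _ _ mF1 mF2.
    apply: subset_measure0 AF.
    + by apply: measurableD => //; exact: measurableD.
    + by apply: measurableU; exact: measurableD.
    + by move=> x [[Ax nF1x] nF2x]; left; split => // -[].
  - by rewrite setDE setIACA setICr setI0.
  - by rewrite setUIDK.
split; first by apply: measurableU; [exact: FF1m|exact: FF2m].
by exists P, Q; split => //; rewrite /null_eq setYK measure0.
Qed.

Lemma family_sum_I2 FF1 FF2 :
  measurable_matroid mu FF1 -> measurable_matroid mu FF2 ->
  axiom_I2 mu (family_sum mu FF1 FF2).
Proof.
move=> mat1 mat2 A B mA /(family_sumP mat1 mat2)[P [Q [FP FQ PQ0 ->]]] AB.
have [[_ [FF1m _] [_ I2 _ _]] [_ [FF2m _] [_ I2' _ _]]] := (mat1, mat2).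
have [mP mQ] := (FF1m _ FP, FF2m _ FQ).
apply/(family_sumP mat1 mat2); exists (A `&` P), (A `\` P); split.
- by apply: (sub_axiom_I2 I2 _ FP) => //; exact: measurableI.
- apply: (I2' _ _ (measurableD mA mP) FQ).
  by rewrite /null_subset setDDl.
- by rewrite setDE setIACA setICr setI0.
- by rewrite setUIDK.
Qed.

End matroid_sum.

Theorem theorem4p11 (R : realType) (d : measure_display) (J : measurableType d)
    (mu : {finite_measure set J -> \bar R}) (FF1 FF2 : set (set J)) :
  measurable_matroid mu FF1 -> measurable_matroid mu FF2 ->
  measurable_pre_matroid mu (family_sum mu FF1 FF2).
Proof.
move=> mat1 mat2; have I2 := family_sum_I2 _ _ _ mu FF1 FF2 mat1 mat2.
have sumP A := @family_sumP _ _ _ mu FF1 FF2 A mat1 mat2.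
have [[std _ [I1 _ _ _]] [_ _ [I1' _ _ _]]] := (mat1, mat2).
split=> //; first split.
- by move=> A [].
- move=> A B FA mB AB; apply: (I2 _ _ mB FA); have [mA _] := FA.
  apply: subset_measure0 AB; [exact: measurableD| |exact: subsetUr].
  by apply: measurableU; exact: measurableD.
split=> //.
- by apply/sumP; exists set0, set0; rewrite setI0 setU0.
- move=> A B /sumP[P [Q [FP FQ PQ0 ->]]] /sumP[B1 [B2 [FB1 FB2 B12 ->]]] _.
  have [[G1 G2] [FG1 FG2 G0 subG Gsub] large] :=
    disjoint_cover_large _ _ _ mu mat1 mat2 FP FQ PQ0 FB1 FB2 B12.
  exists (G1 `|` G2); split => //; try exact: sub_null_subset.
  by apply/sumP; exists G1, G2.
Qed.
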